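(* Suppose that for all fixed $Q>0$, $D>0$ the function $T\mapsto f(T,Q,D)$ is convex and monotonically decreasing for $T>0$. Suppose further that for each $j=1,\dots,N^S-1$ there exists a feasible solution $\tilde s=(\tilde z,\Delta\tilde H^{SP},\Delta\tilde T,\tilde H_{out}^{S})$ of (HOPnr1($\underline z,\overline z$)) such that the outlet temperature $\tilde T_{out}^{S_j}$ of station $j$ in the scheme defined by $\tilde s$ satisfies $\tilde T_{out}^{S_j}=\overline T_{out}^{S_j}$. Then (HOPnr1($\underline z,\overline z$)) and (HOPnr2($\underline z,\overline z$)) have the same optimal objective value.
   Context: Data of the heated oil pipeline (HOP) problem. There are $N^S$ stations $j=1,\dots,N^S$; the pipe between stations $j$ and $j+1$ is divided into $N^P_j\ge 1$ segments $r=1,\dots,N^P_j$. The given constants are: $C_p,C_f,V_c,\rho,c,g$; efficiencies $\xi_j^{CP},\xi_j^{SP},\eta_j$; volume flows $Q_{jr}$ ($r\ge 0$); lengths $L_{jr}$; inner and outer diameters $D_{jr},d_{jr}$; heat transfer coefficients $K_{jr}$; elevation differences $\Delta Z_{jr}\in\mathbb R$; pump heads $H_j^{CP}$ and $\underline H_j^{SP}\le\overline H_j^{SP}$; temperatures $T_g^{P_{jr}},T_f^{P_{jr}}$; integer bounds $\underline z=(\underline x,\underline y)$, $\overline z=(\overline x,\overline y)$; and the lower and upper bounds (underlined/overlined) on heads and temperatures appearing below. All constants related to price, efficiency, flow, length, diameter, head, temperature and friction are nonnegative, and those occurring in denominators, as well as $Q_{jr},D_{jr}$, are positive. Put $\alpha_{jr}=K_{jr}\pi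 d_{jr}/(\rho Q_{jr}c)$. $f(T,Q,D)$ is a given real-valued function (evaluated at positive temperatures $T$). The inlet head and temperature of station 1 are given: $\underline H_{in}^{S_1}=\overline H_{in}^{S_1}$, $\underline T_{in}^{S_1}=\overline T_{in}^{S_1}$. Variables (a scheme $\Psi$): $x_j,y_j,\Delta H_j^{SP},\Delta T_j,H_{out}^{S_j},T_{out}^{S_j}$ ($1\le j\le N^S-1$); $H_{in}^{S_j},T_{in}^{S_j}$ ($1\le j\le N^S$); $H_{out}^{P_{jr}},T_{out}^{P_{jr}}$ ($0\le r\le N^P_j$) and $T_{ave}^{P_{jr}},F_{jr}$ ($1\le r\le N^P_j$), for $1\le j\le N^S-1$. Write $z=(x,y)$. Constraints (for $j=1,\dots,N^S-1$ and $r=1,\dots,N^P_j$ unless specified): (a) $H_{out}^{P_{jr}}=H_{out}^{P_{j,r-1}}-F_{jr}-\Delta Z_{jr}$; (b) $F_{jr}=f(T_{ave}^{P_{jr}},Q_{jr},D_{jr})L_{jr}$; (c) $T_{out}^{P_{jr}}=T_g^{P_{jr}}+T_f^{P_{jr}}+[T_{out}^{P_{j,r-1}}-(T_g^{P_{jr}}+T_f^{P_{jr}})]e^{-\alpha_{jr}L_{jr}}$; (d) $T_{ave}^{P_{jr}}=\frac13T_{out}^{P_{j,r-1}}+\frac23T_{out}^{P_{jr}}$; (e) $H_{in}^{S_j}+x_jH_j^{CP}+\Delta H_j^{SP}\ge H_{out}^{S_j}$; (f) $y_j\underline H_j^{SP}\le\Delta H_j^{SP}\le y_j\overline H_j^{SP}$;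 (g) $T_{in}^{S_j}+\Delta T_j=T_{out}^{S_j}$, $\Delta T_j\ge0$; (h) $T_{out}^{P_{j0}}=T_{out}^{S_j}$, $T_{out}^{P_{jN^P_j}}=T_{in}^{S_{j+1}}$, $H_{out}^{P_{j0}}=H_{out}^{S_j}$, $H_{out}^{P_{jN^P_j}}=H_{in}^{S_{j+1}}$; (i) $\underline H_{in}^{S_j}\le H_{in}^{S_j}\le\overline H_{in}^{S_j}$ and $\underline T_{in}^{S_j}\le T_{in}^{S_j}\le\overline T_{in}^{S_j}$ for $j=1,\dots,N^S$; $\underline H_{out}^{S_j}\le H_{out}^{S_j}\le\overline H_{out}^{S_j}$ and $\underline T_{out}^{S_j}\le T_{out}^{S_j}\le\overline T_{out}^{S_j}$ for $j\le N^S-1$; $\underline H_{out}^{P_{jr}}\le H_{out}^{P_{jr}}\le\overline H_{out}^{P_{jr}}$ for $r=1,\dots,N^P_j-1$; (k) $x_j\in[\underline x_j,\overline x_j]$, $y_j\in[\underline y_j,\overline y_j]$ (real); (l) $F_{jr}\ge f(T_{ave}^{P_{jr}},Q_{jr},D_{jr})L_{jr}$. Objective: $C(x,\Delta H^{SP},\Delta T)=\sum_{j=1}^{N^S-1}\big[C_p\rho Q_{j0}g\big(\frac{x_jH_j^{CP}}{\xi_j^{CP}}+\frac{\Delta H_j^{SP}}{\xi_j^{SP}}\big)+C_fc\rho Q_{j0}\frac{\Delta T_j}{\eta_jV_c}\big]$. (HOPnr1($\underline z,\overline z$)): minimize $C$ over $\Psi$ subject to (a)-(i),(k). (HOPnr2($\underline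 z,\overline z$)): minimize $C$ subject to (a),(c)-(i),(k),(l) (that is, (b) is relaxed to (l)). A vector $s=(z,\Delta H^{SP},\Delta T,H_{out}^S)$ determines a unique scheme $\Psi$ satisfying all equality constraints of (HOPnr1); $s$ is called feasible if this scheme satisfies all inequality constraints. *)

(* Defs.v *)
From HB Require Import structures.
From mathcomp Require Import all_boot all_order all_algebra.
From mathcomp Require Import all_classical all_reals all_analysis.
Import Order.TTheory GRing.Theory Num.Theory.

Set Implicit Arguments.
Unset Strict Implicit.
Unset Printing Implicit Defensive.

Local Open Scope classical_set_scope.
Local Open Scope ring_scope.

(* Stations are numbered from 1 and the segments of a pipe are ragged, so every
   indexed quantity is a function on [nat]; its values outside the index ranges
   of the problem occur neither in the constraints nor in the objective. *)
Record hop_data (R : realType) := HopData {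
  NS : nat;
  NP : nat -> nat;
  Cp : R; Cf : R; Vc : R; rho : R; cheat : R; grav : R;
  xiCP : nat -> R; xiSP : nat -> R; eta : nat -> R;
  Q : nat -> nat -> R;
  L : nat -> nat -> R;
  Din : nat -> nat -> R;                   (* inner diameter, D_jr *)
  dout : nat -> nat -> R;                  (* outer diameter, d_jr *)
  K : nat -> nat -> R;
  DZ : nat -> nat -> R;
  HCP : nat -> R; HSPlo : nat -> R; HSPhi : nat -> R;
  Tg : nat -> nat -> R; Tf : nat -> nat -> R;
  HinLo : nat -> R; HinHi : nat -> R;
  TinLo : nat -> R; TinHi : nat -> R;
  HoutLo : nat -> R; HoutHi : nat -> R;
  ToutLo : nat -> R; ToutHi : nat -> R;
  HPLo : nat -> nat -> R; HPHi : nat -> nat -> R;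
  f : R -> R -> R -> R                     (* f T Q D; meaningful for 0 < T *)
}.

(* An integer vector z = (x, y), used for the bounds on the pump numbers. *)
Record zbound := ZBound { xb : nat -> int; yb : nat -> int }.

(* The decision vector s = (z, DeltaH^SP, DeltaT, H_out^S). *)
Record solution (R : realType) := Solution {
  xv : nat -> R; yv : nat -> R;
  dHSP : nat -> R; dT : nat -> R;
  HoutS : nat -> R
}.

Record scheme (R : realType) := Scheme {
  sol :> solution R;
  ToutS : nat -> R;
  HinS : nat -> R; TinS : nat -> R;
  HoutP : nat -> nat -> R; ToutP : nat -> nat -> R;
  Tave : nat -> nat -> R; F : nat -> nat -> R
}.

Section HOP.
Context {R : realType} (d : hop_data R).
Implicit Types (s : solution R) (Psi : scheme R) (j r : nat) (zl zu : zbound).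

Definition is_station j := (1 <= j <= NS d)%N.
Definition is_pipe j := (1 <= j < NS d)%N.
Definition is_segment j r := is_pipe j && (1 <= r <= NP d j)%N.

Record hop_data_ok : Prop := HopDataOk {
  NS_ge1 : (1 <= NS d)%N;
  NP_ge1 : forall j, is_pipe j -> (1 <= NP d j)%N;
  constants_ok :
    [/\ 0 <= Cp d, 0 <= Cf d & 0 <= grav d] /\
    [/\ 0 < Vc d, 0 < rho d & 0 < cheat d];
  efficiencies_ok : forall j, is_pipe j ->
    [/\ 0 < xiCP d j, 0 < xiSP d j & 0 < eta d j];
  flows_ok : forall j r, is_pipe j -> (r <= NP d j)%N -> 0 < Q d j r;
  segments_ok : forall j r, is_segment j r ->
    [/\ 0 <= L d j r, 0 < Din d j r, 0 <= dout d j r & 0 <= K d j r] /\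
    (0 <= Tg d j r /\ 0 <= Tf d j r);
  pumps_ok : forall j, is_pipe j -> 0 <= HCP d j /\ 0 <= HSPlo d j <= HSPhi d j;
  inlet_bounds_ok : forall j, is_station j ->
    [/\ 0 <= HinLo d j, 0 <= HinHi d j, 0 <= TinLo d j & 0 <= TinHi d j];
  outlet_bounds_ok : forall j, is_pipe j ->
    [/\ 0 <= HoutLo d j, 0 <= HoutHi d j, 0 <= ToutLo d j & 0 <= ToutHi d j];
  pipe_bounds_ok : forall j r, is_pipe j -> (1 <= r < NP d j)%N ->
    0 <= HPLo d j r /\ 0 <= HPHi d j r;
  inlet1_given : HinLo d 1 = HinHi d 1 /\ TinLo d 1 = TinHi d 1
}.

Definition alpha j r : R :=
  K d j r * pi * dout d j r / (rho d * Q d j r * cheat d).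

Definition head_balance Psi := forall j r, is_segment j r ->
  HoutP Psi j r = HoutP Psi j r.-1 - F Psi j r - DZ d j r.

(* [f] is a function of positive temperatures only, so the friction equation
   and its relaxation both presuppose that T_ave lies in its domain. *)
Definition friction_eq Psi := forall j r, is_segment j r ->
  0 < Tave Psi j r /\
  F Psi j r = f d (Tave Psi j r) (Q d j r) (Din d j r) * L d j r.

Definition friction_ge Psi := forall j r, is_segment j r ->
  0 < Tave Psi j r /\
  f d (Tave Psi j r) (Q d j r) (Din d j r) * L d j r <= F Psi j r.

Definition temperature_drop Psi := forall j r, is_segment j r ->
  ToutP Psi j r = Tg d j r + Tf d j r +
    (ToutP Psi j r.-1 - (Tg d j r + Tf d j r)) * expR (- (alpha j r * L d j r)).

Definition average_temperature Psi := forall j r, is_segment j r ->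
  Tave Psi j r = 1 / 3 * ToutP Psi j r.-1 + 2 / 3 * ToutP Psi j r.

Definition station_head Psi := forall j, is_pipe j ->
  HoutS Psi j <= HinS Psi j + xv Psi j * HCP d j + dHSP Psi j.

Definition SP_head_bounds Psi := forall j, is_pipe j ->
  yv Psi j * HSPlo d j <= dHSP Psi j <= yv Psi j * HSPhi d j.

Definition station_temperature Psi := forall j, is_pipe j ->
  TinS Psi j + dT Psi j = ToutS Psi j.

Definition heating_ge0 Psi := forall j, is_pipe j -> 0 <= dT Psi j.

Definition junctions Psi := forall j, is_pipe j ->
  [/\ ToutP Psi j 0 = ToutS Psi j, ToutP Psi j (NP d j) = TinS Psi j.+1,
      HoutP Psi j 0 = HoutS Psi j & HoutP Psi j (NP d j) = HinS Psi j.+1].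

Definition state_bounds Psi :=
  [/\ forall j, is_station j ->
        HinLo d j <= HinS Psi j <= HinHi d j /\
        TinLo d j <= TinS Psi j <= TinHi d j,
      forall j, is_pipe j ->
        HoutLo d j <= HoutS Psi j <= HoutHi d j /\
        ToutLo d j <= ToutS Psi j <= ToutHi d j
    & forall j r, is_pipe j -> (1 <= r < NP d j)%N ->
        HPLo d j r <= HoutP Psi j r <= HPHi d j r].

Definition pump_bounds zl zu Psi := forall j, is_pipe j ->
  (xb zl j)%:~R <= xv Psi j <= (xb zu j)%:~R /\
  (yb zl j)%:~R <= yv Psi j <= (yb zu j)%:~R.

(* All equality constraints except the friction equation. *)
Definition flow_equations Psi :=
  [/\ head_balance Psi, temperature_drop Psi, average_temperature Psi,
      station_temperature Psi & junctions Psi].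

Definition inequalities zl zu Psi :=
  [/\ station_head Psi, SP_head_bounds Psi, heating_ge0 Psi,
      state_bounds Psi & pump_bounds zl zu Psi].

Definition HOPnr1 zl zu : set (scheme R) :=
  [set Psi | [/\ flow_equations Psi, friction_eq Psi & inequalities zl zu Psi]].

Definition HOPnr2 zl zu : set (scheme R) :=
  [set Psi | [/\ flow_equations Psi, friction_ge Psi & inequalities zl zu Psi]].

(* [Psi] is the scheme determined by [s]: starting from the given inlet state
   of station 1, the equality constraints fix all remaining variables. *)
Definition scheme_of s Psi :=
  [/\ sol Psi = s, HinS Psi 1 = HinLo d 1, TinS Psi 1 = TinLo d 1,
      flow_equations Psi & friction_eq Psi].

Definition cost s : R :=
  \sum_(1 <= j < NS d)
    (Cp d * rho d * Q d j 0 * grav d *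
       (xv s j * HCP d j / xiCP d j + dHSP s j / xiSP d j) +
     Cf d * cheat d * rho d * Q d j 0 * (dT s j / (eta d j * Vc d))).

(* Infimum in the extended reals: [+oo] for an infeasible problem. *)
Definition optimal_value (S : set (scheme R)) : \bar R :=
  ereal_inf [set (cost (sol Psi))%:E | Psi in S].

Definition friction_convex_decreasing := forall Q0 D0 : R, 0 < Q0 -> 0 < D0 ->
  convex_function (E := R^o) [set` `]0, +oo[] (fun T => f d T Q0 D0) /\
  {in `]0, +oo[ &, nonincreasing_fun (fun T => f d T Q0 D0)}.

End HOP.

(* Main.v *)
(** Every scheme feasible for (HOPnr1) is feasible for (HOPnr2). Conversely, let
    [h] be the head profile along a pipe of a scheme feasible for (HOPnr2), and
    keep its temperatures and pumps. Its friction exceeds the true one, which in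
    turn exceeds that of the scheme with the maximal outlet temperature in that
    pipe, whose head profile is [k]. So, with [G] the cumulated true friction
    and elevation, [h + G] decreases and [k + G] increases along the pipe, and
    some level [u] lies between the two everywhere. The profile [u - G] obeys the
    friction equation, lies between [h] and [k], hence within the head bounds,
    starts at most at the head of [h] and ends at least at it. As the cost does
    not involve the heads, it is unchanged. *)

Require Import Defs.
From mathcomp Require Import all_boot all_order all_algebra.
From mathcomp Require Import all_classical all_reals all_analysis.
From mathcomp Require Import lra.
Import Order.TTheory GRing.Theory Num.Theory.

(** Induction on [n]: the old level is lowered, if necessary, to the larger of the two new end
    values. The range [a n <= u <= a 0] is carried along to bound [u] below by [a n.+1] in the
    step. *)
Lemma opposite_monotone_level (R : realType) (n : nat) (a b : nat -> R)
    (a_dec : forall r : nat, (r < n)%N -> (a r.+1 <= a r)%R)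
    (b_inc : forall r : nat, (r < n)%N -> (b r <= b r.+1)%R) :
  exists u : R, (a n <= u <= a 0)%R /\
    forall r : nat, (r <= n)%N ->
      (Num.min (a r) (b r) <= u <= Num.max (a r) (b r))%R.
Proof.
elim: n a_dec b_inc => [|n IHn] a_dec b_inc.
  exists (a 0); split=> [|[|//] _]; first by rewrite lexx.
  by rewrite ge_min le_max lexx.
have [r ltrn|r ltrn|u [/andP[an_u u_a0] u_bd]] := IHn.
- exact/a_dec/ltnW.
- exact/b_inc/ltnW.
have b_mono r : (r <= n.+1)%N -> (b r <= b n.+1)%R.
  (* The upper index varies below the fixed [n.+1], since [b_inc] is available only there. *)
  elim: {1 3 4}n.+1 (leqnn n.+1) => [|m IHm] lemn; first by rewrite leqn0 => /eqP->.
  rewrite leq_eqVlt => /orP[/eqP-> //|lerm].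
  exact: le_trans (IHm (ltnW lemn) lerm) (b_inc _ lemn).
exists (Num.min u (Num.max (a n.+1) (b n.+1))); split.
  by rewrite le_min le_max lexx (le_trans (a_dec n _) an_u)//= ge_min u_a0.
move=> r; rewrite leq_eqVlt => /orP[/eqP->|].
  rewrite [X in _ && X]ge_min lexx orbT andbT ge_min !le_min !le_max !lexx !orbT.
  by rewrite (le_trans (a_dec n _) an_u).
rewrite ltnS => lern; have /andP[lo_u u_hi] := u_bd r lern.
(* Lowering [u] keeps the upper bounds; the lower ones survive because [b r <= b n.+1]. *)
rewrite [X in _ && X]ge_min u_hi andbT le_min lo_u ge_min !le_max.
by rewrite b_mono ?orbT// leqW.
Qed.

Section Friction.
Context {R : realType} (d : hop_data R).
Hypothesis d_ok : hop_data_ok d.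
Hypothesis f_convex_decreasing : friction_convex_decreasing d.
Local Open Scope ring_scope.

(** Across a segment the temperature undergoes an affine map of positive slope, the same for both
    schemes, so the order at the pipe inlet propagates. *)
Lemma pipe_temperature_le (Psi Psi' : scheme R) (j r : nat) :
    is_pipe d j -> flow_equations d Psi -> flow_equations d Psi' ->
    ToutS Psi j <= ToutS Psi' j -> (r <= NP d j)%N ->
  ToutP Psi j r <= ToutP Psi' j r.
Proof.
move=> pj [_ drop _ _ junc] [_ drop' _ _ junc'] leT.
elim: r => [|r IHr] ler.
  by have [-> _ _ _] := junc j pj; have [-> _ _ _] := junc' j pj.
have sjr : is_segment d j r.+1 by rewrite /is_segment pj.
rewrite drop// drop'// lerD2l ler_wpM2r ?expR_ge0// lerD2r.
exact/IHr/ltnW.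
Qed.

(** Hotter oil flows with less friction. Positivity of the cooler average puts both temperatures in
    the domain where [f] decreases. *)
Lemma friction_le (Psi Psi' : scheme R) (j r : nat) :
    is_segment d j r -> flow_equations d Psi -> flow_equations d Psi' ->
    ToutS Psi j <= ToutS Psi' j -> 0 < Tave Psi j r ->
  f d (Tave Psi' j r) (Q d j r) (Din d j r) * L d j r <=
    f d (Tave Psi j r) (Q d j r) (Din d j r) * L d j r.
Proof.
move=> sjr E E' leT T_gt0; have /andP[pj /andP[r_gt0 ler]] := sjr.
have leTave : Tave Psi j r <= Tave Psi' j r.
  have := pipe_temperature_le _ _ _ _ pj E E' leT ler.
  have := pipe_temperature_le _ _ _ _ pj E E' leT (leq_trans (leq_pred r) ler).
  case: E E' => _ _ avg _ _ [_ _ avg' _ _].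
  by rewrite avg// avg'//; lra.
have [[L_ge0 D_gt0 _ _] _] := segments_ok d_ok sjr.
have Q_gt0 := flows_ok d_ok pj ler.
have [_ f_dec] := f_convex_decreasing _ _ Q_gt0 D_gt0.
apply: ler_wpM2r => //; apply: f_dec => //; rewrite in_itv/= andbT//.
exact: lt_le_trans leTave.
Qed.

(** The friction is the one prescribed by [f], not the variable [F], which may exceed it in
    [HOPnr2]. *)
Definition cumulated_loss (Psi : scheme R) (j r : nat) : R :=
  \sum_(1 <= i < r.+1)
    (f d (Tave Psi j i) (Q d j i) (Din d j i) * L d j i + DZ d j i).

Lemma cumulated_loss0 (Psi : scheme R) (j : nat) : cumulated_loss Psi j 0 = 0.
Proof. by rewrite /cumulated_loss big_geq. Qed.

Lemma cumulated_lossS (Psi : scheme R) (j r : nat) :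
  cumulated_loss Psi j r.+1 = cumulated_loss Psi j r +
    (f d (Tave Psi j r.+1) (Q d j r.+1) (Din d j r.+1) * L d j r.+1 +
     DZ d j r.+1).
Proof. by rewrite /cumulated_loss big_nat_recr. Qed.

Lemma pipe_head_level (zl zu : zbound) (Psi Psi' : scheme R) (j : nat) :
    is_pipe d j -> HOPnr2 d zl zu Psi -> HOPnr1 d zl zu Psi' ->
    ToutS Psi j <= ToutS Psi' j ->
  exists u : R,
    [/\ u <= HoutP Psi j 0,
        HoutP Psi j (NP d j) <= u - cumulated_loss Psi j (NP d j)
      & forall r, (r <= NP d j)%N ->
          Num.min (HoutP Psi j r) (HoutP Psi' j r) <=
            u - cumulated_loss Psi j r <=
          Num.max (HoutP Psi j r) (HoutP Psi' j r)].
Proof.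
move=> pj [E fr _] [E' fr' _] leT.
pose G := cumulated_loss Psi j.
have sj r : (r < NP d j)%N -> is_segment d j r.+1 by rewrite /is_segment pj.
(* Both profiles are shifted by the loss [G] of [Psi]. The range of [u] then yields the two end
   conditions. *)
have [r ltr|r ltr|u [/andP[u_lo u_hi] u_bd]] := opposite_monotone_level R
    (NP d j) (fun r => HoutP Psi j r + G r) (fun r => HoutP Psi' j r + G r).
- have [head _ _ _ _] := E.
  have [_] := fr _ _ (sj _ ltr).
  by rewrite head ?sj// /G cumulated_lossS /=; lra.
- have [T_gt0 _] := fr _ _ (sj _ ltr).
  have := friction_le _ _ _ _ (sj _ ltr) E E' leT T_gt0.
  have [head _ _ _ _] := E'.
  have [_ <-] := fr' _ _ (sj _ ltr).
  by rewrite (head j r.+1) ?sj// /G cumulated_lossS /=; lra.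
exists u; split.
- by move: u_hi; rewrite /G cumulated_loss0 addr0.
- by rewrite lerBrDr.
- move=> r /u_bd; rewrite -addr_minl -addr_maxl => /andP[lo hi].
  by rewrite lerBrDr lerBlDr lo.
Qed.

End Friction.

Lemma between_min_max (R : realType) (lo hi x y v : R) :
    (lo <= x <= hi)%R -> (lo <= y <= hi)%R ->
    (Num.min x y <= v <= Num.max x y)%R ->
  (lo <= v <= hi)%R.
Proof.
move=> /andP[lox xhi] /andP[loy yhi] /andP[lo_v v_hi].
by rewrite (le_trans _ lo_v) ?le_min ?lox// (le_trans v_hi)// ge_max xhi.
Qed.

Section Repair.
Context {R : realType} (d : hop_data R) (Psi : scheme R) (u : nat -> R).
Local Open Scope ring_scope.

(** The level [u j] is the head at the start of pipe [j], where no loss has accumulated. *)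
Definition repaired_head (j r : nat) : R := u j - cumulated_loss d Psi j r.

Definition repaired_scheme : scheme R :=
  Scheme (Solution (xv Psi) (yv Psi) (dHSP Psi) (dT Psi) u)
    (ToutS Psi)
    (* Station 1 has no incoming pipe and keeps its given inlet head. *)
    (fun j => if (j <= 1)%N then HinS Psi j
              else repaired_head j.-1 (NP d j.-1))
    (TinS Psi) repaired_head (ToutP Psi) (Tave Psi)
    (fun j r => f d (Tave Psi j r) (Q d j r) (Din d j r) * L d j r).

(** The scheme [Psi'] may change with the pipe: it serves only to keep the repaired heads of that
    pipe between two admissible values. *)
Lemma repaired_scheme_feasible (zl zu : zbound) :
    HOPnr2 d zl zu Psi ->
    (forall j, is_pipe d j -> exists Psi' : scheme R,
      [/\ HOPnr1 d zl zu Psi', u j <= HoutP Psi j 0,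
          HoutP Psi j (NP d j) <= repaired_head j (NP d j)
        & forall r, (r <= NP d j)%N ->
            Num.min (HoutP Psi j r) (HoutP Psi' j r) <= repaired_head j r <=
              Num.max (HoutP Psi j r) (HoutP Psi' j r)]) ->
  HOPnr1 d zl zu repaired_scheme.
Proof.
move=> [[head drop avg stT junc] fr [stH SP heat [bS bO bP] pump]] level.
have HinS_le j : is_station d j -> HinS Psi j <= HinS repaired_scheme j.
  move=> /andP[j_gt0 jNS] /=; case: leqP => // j_gt1.
  have pj : is_pipe d j.-1 by rewrite /is_pipe; case: j j_gt1 jNS {j_gt0} => [|[]].
  have [_ _ _] := junc _ pj; rewrite prednK// => <-.
  by have [Psi' []] := level _ pj.
have pipe_station j : is_pipe d j -> is_station d j.
  by move=> /andP[j_gt0 /ltnW jNS]; rewrite /is_station j_gt0.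
have friction : friction_eq d repaired_scheme.
  by move=> j r sjr; have [T_gt0 _] := fr j r sjr.
split=> //; split=> //.
- move=> j r /andP[_ /andP[r_gt0 _]]; rewrite /= /repaired_head.
  by rewrite -{1}(prednK r_gt0) cumulated_lossS prednK//; lra.
- move=> j pj; have [ToutE TinE HoutE HinE] := junc j pj; split=> //=.
    by rewrite /repaired_head cumulated_loss0 subr0.
  by have /andP[j_gt0 _] := pj; rewrite ltnS leqNgt j_gt0.
(* The outlet head does not rise, the inlet head does not fall, and the pumps are unchanged. *)
- move=> j pj; have [Psi' [_ u_le _ _]] := level j pj.
  have [_ _ HoutE _] := junc j pj; rewrite HoutE in u_le.
  apply: le_trans u_le (le_trans (stH j pj) _).
  exact: lerD (lerD (HinS_le _ (pipe_station _ pj)) (lexx _)) (lexx _).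
split.
- move=> j sj; have [bH bT] := bS j sj; split=> //.
  have /andP[j_gt0 jNS] := sj; rewrite /=; case: leqP => // j_gt1.
  have pj : is_pipe d j.-1 by rewrite /is_pipe; case: j j_gt1 jNS {j_gt0 sj bH bT} => [|[]].
  have [Psi' [[[_ _ _ _ junc'] _ [_ _ _ [bS' _ _] _]] _ _ /(_ _ (leqnn _))]] :=
    level _ pj.
  have [_ _ _] := junc _ pj; rewrite prednK// => ->.
  have [_ _ _] := junc' _ pj; rewrite prednK// => ->.
  by have [bH' _] := bS' j sj; apply: between_min_max.
- move=> j pj; have [bH bT] := bO j pj; split=> //=.
  have [Psi' [[[_ _ _ _ junc'] _ [_ _ _ [_ bO' _] _]] _ _ /(_ _ (leq0n _))]] :=
    level _ pj.
  rewrite /repaired_head cumulated_loss0 subr0.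
  have [_ _ -> _] := junc _ pj; have [_ _ -> _] := junc' _ pj.
  by have [bH' _] := bO' j pj; apply: between_min_max.
- move=> j r pj rj; have bH := bP j r pj rj.
  have /andP[_ /ltnW rN] := rj.
  have [Psi' [[_ _ [_ _ _ [_ _ bP'] _]] _ _ /(_ _ rN)]] := level _ pj.
  exact: between_min_max (bP' j r pj rj).
Qed.

End Repair.

Lemma HOPnr1_sub_HOPnr2 (R : realType) (d : hop_data R) (zl zu : zbound) :
  (HOPnr1 d zl zu `<=` HOPnr2 d zl zu)%classic.
Proof.
move=> Psi [E fr ineq]; split=> // j r sjr.
by have [? ->] := fr j r sjr; split.
Qed.

Theorem theorem1 (R : realType) (d : hop_data R) (zl zu : zbound)
    (d_ok : hop_data_ok d)
    (f_convex_decreasing : friction_convex_decreasing d)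
    (max_outlet_temperature : forall j : nat, is_pipe d j ->
       exists (s : solution R) (Psi : scheme R),
         [/\ scheme_of d s Psi, inequalities d zl zu Psi
           & ToutS Psi j = ToutHi d j]) :
  optimal_value d (HOPnr1 d zl zu) = optimal_value d (HOPnr2 d zl zu).
Proof.
apply/eqP; rewrite eq_le; apply/andP; split; last first.
  exact/ereal_inf_le_tmp/image_subset/HOPnr1_sub_HOPnr2.
apply: ereal_inf_le_tmp => _ [Psi feas <-].
(* The condition [is_pipe d j] sits under the existential so that choice gives a total function,
   with value 0 off the pipes. *)
have level j : exists v : R, is_pipe d j -> exists Psi' : scheme R,
    [/\ HOPnr1 d zl zu Psi', (v <= HoutP Psi j 0)%R,
        (HoutP Psi j (NP d j) <= v - cumulated_loss d Psi j (NP d j))%R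
      & forall r, (r <= NP d j)%N ->
          (Num.min (HoutP Psi j r) (HoutP Psi' j r) <=
             v - cumulated_loss d Psi j r <=
           Num.max (HoutP Psi j r) (HoutP Psi' j r))%R].
  have [pj|npj] := boolP (is_pipe d j); last by exists 0%R.
  have [s [Psi' [[_ _ _ E' fr'] ineq' ToutE]]] := max_outlet_temperature j pj.
  have feas' : HOPnr1 d zl zu Psi' by [].
  have leT : (ToutS Psi j <= ToutS Psi' j)%R.
    have [_ _ [_ _ _ [_ bO _] _]] := feas.
    by have [_ /andP[_]] := bO j pj; rewrite ToutE.
  have [v [v0 vN v_bd]] := pipe_head_level d d_ok f_convex_decreasing
    _ _ _ _ _ pj feas feas' leT.
  by exists v => _; exists Psi'.
have [u u_level] := choice level.
exists (repaired_scheme d Psi u) => //.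
exact: repaired_scheme_feasible.
Qed.
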